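(* Let $G$ be a connected $n$-vertex graph with maximum degree at most $3$ that is not isomorphic to any of $C_4$, $C_4'$, $K_4$. Then \[\iota(G, C_4) \leq \left\lfloor \frac{n}{5} \right\rfloor.\]
   Context: All graphs are finite and simple. For a graph $G$ and $D \subseteq V(G)$, $N[D]$ denotes the closed neighbourhood of $D$ and $G - N[D]$ the subgraph induced by $V(G)\setminus N[D]$. A set $D \subseteq V(G)$ is a $C_4$-isolating set of $G$ if $G - N[D]$ contains no subgraph isomorphic to the $4$-cycle $C_4$; $\iota(G, C_4)$ is the minimum size of such a set. $C_4'$ is the diamond graph on $\{1,2,3,4\}$ with edges $12,23,34,41,13$, and $K_4$ is the complete graph on $4$ vertices. *)

(* Defs.v *)
From mathcomp Require Import all_boot.
Set Implicit Arguments. Unset Strict Implicit. Unset Printing Implicit Defensive.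

Definition simple_graph (T : finType) (e : rel T) : Prop :=
  symmetric e /\ irreflexive e.

Definition connected_graph (T : finType) (e : rel T) : Prop :=
  forall x y : T, connect e x y.

Definition max_degree_le (T : finType) (e : rel T) (k : nat) : Prop :=
  forall x : T, #|[set y | e x y]| <= k.

Definition closed_nbhd (T : finType) (e : rel T) (D : {set T}) : {set T} :=
  [set v | (v \in D) || [exists u in D, e u v]].

Definition has_C4_in (T : finType) (e : rel T) (S : {set T}) : Prop :=
  exists a b c d : T,
    [/\ [/\ a \in S, b \in S, c \in S & d \in S],
        uniq [:: a; b; c; d] &
        [/\ e a b, e b c, e c d & e d a]].

Definition C4_isolating (T : finType) (e : rel T) (D : {set T}) : Prop :=
  ~ has_C4_in e (~: closed_nbhd e D).

Definition isomorphic (T U : finType) (e : rel T) (f : rel U) : Prop :=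
  exists phi : T -> U, bijective phi /\ forall x y, f (phi x) (phi y) = e x y.

(* The three exceptional graphs on vertex set 'I_4 = {0,1,2,3}
   (paper's vertices 1,2,3,4 are 0,1,2,3 here). *)
Definition edge_from_list (l : seq (nat * nat)) : rel 'I_4 :=
  fun x y => ((nat_of_ord x, nat_of_ord y) \in l) || ((nat_of_ord y, nat_of_ord x) \in l).

Definition C4_rel : rel 'I_4 := edge_from_list [:: (0,1); (1,2); (2,3); (3,0)].
Definition diamond_rel : rel 'I_4 := edge_from_list [:: (0,1); (1,2); (2,3); (3,0); (0,2)].
Definition K4_rel : rel 'I_4 := fun x y => x != y.

(* Main.v *)
(** In a subcubic graph a 4-cycle through [x] uses two of the at most three edges
at [x], so it meets every pair of neighbours of [x].  Hence the closed
neighbourhood of any single vertex of a 4-cycle [Q] meets every 4-cycle that meets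
[Q].  One proves by induction on [#|S|] that an induced subgraph [G[S]] without
4-vertex components containing a 4-cycle is isolated by at most [#|S| / 5]
vertices.  The step removes a suitable set [R] together with all the bad 4-vertex
components left over in [S :\: R], each of which has a neighbour in [R], and
dominates all these by few vertices of [R]: [R] is a cut vertex, a [K_{2,3}], a
4-cycle, or a 4-cycle with one more vertex adjacent to it. *)

Require Import Defs.
From mathcomp Require Import all_boot.
From mathcomp Require Import zify.

Set Implicit Arguments.
Unset Strict Implicit.
Unset Printing Implicit Defensive.

Section Isolation.

Context (T : finType) (e : rel T).
Hypotheses (eG : simple_graph e) (degG : max_degree_le e 3).
Implicit Types (x y z u v w : T) (S Z B D P Q R W : {set T}).

Let eC : symmetric e := proj1 eG.
Let eI : irreflexive e := proj2 eG.

(** * Four-cycles in a subcubic graph *)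

Lemma degree_lt4 x y1 y2 y3 y4 :
  uniq [:: y1; y2; y3; y4] -> e x y1 -> e x y2 -> e x y3 -> e x y4 -> False.
Proof.
move=> /card_uniqP cardY h1 h2 h3 h4.
suff: 4 <= #|[set y | e x y]| by move/leq_trans/(_ (degG x)).
rewrite -[4]/(size [:: y1; y2; y3; y4]) -cardY; apply/subset_leq_card/subsetP=> y.
by rewrite !inE => /or4P[] /eqP->.
Qed.

Definition four_cycle x y z u : bool :=
  [&& uniq [:: x; y; z; u], e x y, e y z, e z u & e u x].

(** Chords are allowed: isolation concerns subgraphs, not only induced ones. *)
Definition is_C4 Z : bool :=
  [exists x, exists y, exists z, exists u,
     (Z == [set x; y; z; u]) && four_cycle x y z u].

Lemma is_C4P Z :
  reflect (exists x y z u, Z = [set x; y; z; u] /\ four_cycle x y z u) (is_C4 Z).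
Proof.
apply: (iffP existsP) => [[x /existsP[y /existsP[z /existsP[u]]]]|].
  by case/andP=> /eqP-> cyc; exists x, y, z, u.
case=> x [y [z [u [-> cyc]]]]; exists x; apply/existsP; exists y.
by apply/existsP; exists z; apply/existsP; exists u; rewrite eqxx.
Qed.

Arguments is_C4P {Z}.

Lemma four_cycle_rot x y z u : four_cycle x y z u -> four_cycle y z u x.
Proof.
case/and5P=> uq h1 h2 h3 h4; apply/and5P; split=> //.
by rewrite -(rot_uniq 3).
Qed.

Lemma set4_rot x y z u : [set x; y; z; u] = [set y; z; u; x].
Proof. by apply/setP=> t; rewrite !inE; do 4!case: eqP => //=. Qed.

Lemma C4_rooted Z x : is_C4 Z -> x \in Z ->
  exists y z u, Z = [set x; y; z; u] /\ four_cycle x y z u.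
Proof.
case/is_C4P=> a [b [c [d [-> cyc]]]]; rewrite !inE -!orbA.
case/or4P=> /eqP->.
- by exists b, c, d.
- by exists c, d, a; rewrite set4_rot; split=> //; apply: four_cycle_rot.
- by exists d, a, b; rewrite 2!set4_rot; split=> //; do 2!apply: four_cycle_rot.
- by exists a, b, c; rewrite 3!set4_rot; split=> //; do 3!apply: four_cycle_rot.
Qed.

Lemma card_C4 Z : is_C4 Z -> #|Z| = 4.
Proof.
case/is_C4P=> a [b [c [d [-> /andP[/card_uniqP/= <- _]]]]].
by apply: eq_card => t; rewrite !inE -!orbA.
Qed.

(** Otherwise [y], [z] and the two cycle neighbours of [x] would be four neighbours of [x]. *)
Lemma C4_meets_pair Z x y z : is_C4 Z -> x \in Z -> y != z -> e x y -> e x z ->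
  (y \in Z) || (z \in Z).
Proof.
move=> cZ xZ yz exy exz; apply/negPn; rewrite negb_or; apply/negP=> /andP[yZ zZ].
have [a [b [c [defZ]]]] := C4_rooted cZ xZ.
case/and5P=> /= uq exa _ _ ecx.
move: yZ zZ; rewrite defZ !inE !negb_or -!andbA.
case/and4P=> _ ya _ yc /and4P[_ za _ zc].
apply: (@degree_lt4 x y z a c) => //; last by rewrite eC.
move: uq; rewrite /= !inE !negb_or -!andbA yz ya yc za zc => /and5P[_ _ _ _ /and3P[ac _ _]].
by rewrite ac.
Qed.

(** * Bad components of an induced subgraph *)

(** Closed under adjacency in [S] and connected through its spanning 4-cycle, [B] is a connected
    component of the subgraph induced by [S]. *)
Definition C4_component S B : bool :=
  [&& B \subset S, is_C4 B & [forall x in B, forall y in S, e x y ==> (y \in B)]].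

Definition C4_components S : {set {set T}} := [set B | C4_component S B].

Lemma C4_componentP S B :
  reflect [/\ B \subset S, is_C4 B
            & forall x y, x \in B -> y \in S -> e x y -> y \in B]
          (B \in C4_components S).
Proof.
rewrite inE; apply: (iffP and3P) => -[sBS cB clB]; split=> //.
  by move=> x y xB yS exy; move/forall_inP/(_ x xB)/forall_inP/(_ y yS)/implyP: clB; exact.
by apply/forall_inP=> x xB; apply/forall_inP=> y yS; apply/implyP; exact: clB.
Qed.

Arguments C4_componentP {S B}.

(** Walking along [Z] from [x] never leaves [B], and both sets have four elements. *)
Lemma C4_component_absorb S B Z x : B \in C4_components S -> is_C4 Z ->
  Z \subset S -> x \in Z -> x \in B -> Z = B.
Proof.
case/C4_componentP=> _ cB clB cZ sZS xZ xB.
apply/eqP; rewrite eqEcard (card_C4 cZ) (card_C4 cB) leqnn andbT.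
have [a [b [c [defZ]]]] := C4_rooted cZ xZ.
case/and5P=> _ exa eab ebc ecx.
have aS : a \in S by rewrite (subsetP sZS) // defZ !inE eqxx ?orbT.
have bS : b \in S by rewrite (subsetP sZS) // defZ !inE eqxx ?orbT.
have cS : c \in S by rewrite (subsetP sZS) // defZ !inE eqxx ?orbT.
have aB := clB _ _ xB aS exa; have bB := clB _ _ aB bS eab.
have {}cB := clB _ _ bB cS ebc.
by apply/subsetP=> t; rewrite defZ !inE -!orbA => /or4P[] /eqP->.
Qed.

Lemma C4_components_disjoint S B B' x : B \in C4_components S ->
  B' \in C4_components S -> x \in B -> x \in B' -> B = B'.
Proof.
move=> BS B'S xB xB'; have [sBS cB _] := C4_componentP BS.
exact: C4_component_absorb B'S cB sBS xB xB'.
Qed.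

Lemma card_cover_C4_components S :
  #|cover (C4_components S)| = 4 * #|C4_components S|.
Proof.
rewrite mulnC; apply: card_uniform_partition => [B /C4_componentP[_ cB _]|].
  exact: card_C4.
apply/and3P; split=> //.
  apply/trivIsetP=> B B' BS B'S; apply: contraR => /pred0Pn[x /andP[xB xB']].
  by apply/eqP; exact: C4_components_disjoint BS B'S xB xB'.
by apply/negP=> /C4_componentP[_ /card_C4]; rewrite cards0.
Qed.

(** * Isolating sets and the reduction step *)

(** [D] is not required to lie inside [S] below, and neighbourhoods are taken in the
whole graph. *)
Definition hits D Z : Prop := exists2 x, x \in Z & x \in closed_nbhd e D.

Definition isolates S D : Prop := forall Z, is_C4 Z -> Z \subset S -> hits D Z.

Definition isolable S : Prop := exists D, isolates S D /\ 5 * #|D| <= #|S|.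

Definition smaller_isolable S : Prop :=
  forall S', S' \proper S -> C4_components S' = set0 -> isolable S'.

Lemma nbhd_self D x : x \in D -> x \in closed_nbhd e D.
Proof. by rewrite inE => ->. Qed.

Lemma nbhd_edge D x y : x \in D -> e x y -> y \in closed_nbhd e D.
Proof.
by move=> xD exy; rewrite inE; apply/orP; right; apply/existsP; exists x; rewrite xD.
Qed.

Lemma hits_sub D D' Z : D \subset D' -> hits D Z -> hits D' Z.
Proof.
move=> sDD' [x xZ]; rewrite inE => /orP[xD|/existsP[u /andP[uD eux]]]; exists x => //.
  exact/nbhd_self/(subsetP sDD').
exact: nbhd_edge (subsetP sDD' _ uD) eux.
Qed.

Lemma hits_via Z D x y z : is_C4 Z -> x \in Z -> y != z -> e x y -> e x z ->
  y \in closed_nbhd e D -> z \in closed_nbhd e D -> hits D Z.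
Proof.
by move=> cZ xZ yz exy exz yD zD; case/orP: (C4_meets_pair cZ xZ yz exy exz);
  [exists y | exists z].
Qed.

(** Only the vertex of [Q] opposite to [q] may be undominated by [q]. Its two neighbours on [Q] are
    dominated, and a 4-cycle through it contains one of them. *)
Lemma C4_hit_from Q q Z x : is_C4 Q -> q \in Q -> is_C4 Z -> x \in Z -> x \in Q ->
  hits [set q] Z.
Proof.
move=> cQ qQ cZ xZ xQ.
have [a [b [c [defQ]]]] := C4_rooted cQ qQ.
case/and5P=> uq eqa eab ebc ecq; have qq : q \in [set q] by rewrite inE.
have nqa := nbhd_edge qq eqa; have nqc : c \in closed_nbhd e [set q].
  by apply: nbhd_edge qq _; rewrite eC.
move: xQ xZ; rewrite defQ !inE -!orbA => /or4P[] /eqP-> xZ.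
- by exists q => //; exact: nbhd_self.
- by exists a.
- apply: (@hits_via Z _ b a c) => //; last by rewrite eC.
  by move: uq; rewrite /= !inE !negb_or -!andbA => /and5P[_ _ _ _ /andP[]].
- by exists c.
Qed.

(** Removing [R] together with the bad components of [S :\: R] creates no new one:
a bad component of what remains would already be one of [S :\: R]. *)
Lemma isolable_reduce S R D :
  smaller_isolable S ->
  R \subset S -> R != set0 ->
  (forall Z x, is_C4 Z -> Z \subset S -> x \in Z -> x \in R -> hits D Z) ->
  (forall B, B \in C4_components (S :\: R) -> hits D B) ->
  5 * #|D| <= #|R| + 4 * #|C4_components (S :\: R)| -> isolable S.
Proof.
move=> IH sRS R0 hitR hitB cardD.
set bs := C4_components (S :\: R) in hitB cardD *.
have sbs : cover bs \subset S :\: R.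
  by apply/bigcupsP=> B /C4_componentP[].
pose S' := S :\: R :\: cover bs.
have sS'S : S' \subset S by apply/(subset_trans (subsetDl _ _))/subsetDl.
(* Each bad component has four vertices, so [D] costs at most a fifth of what is removed. *)
have cardS' : #|S'| + (#|R| + 4 * #|bs|) = #|S|.
  rewrite -card_cover_C4_components -/bs.
  have := cardsID (cover bs) (S :\: R); rewrite -/S' (setIidPr sbs).
  by have := cardsID R S; rewrite (setIidPr sRS); lia.
have [| |D' [isoD' cardD']] := IH S'.
- rewrite properEcard sS'S -cardS' -[X in X < _]addn0 ltn_add2l.
  by rewrite addn_gt0 card_gt0 R0.
- apply/eqP; apply: contraT => /set0Pn[B BS'].
  have [sBS' cB clB] := C4_componentP BS'.
  have Bbs : B \in bs.
    apply/C4_componentP; split=> //; first exact: subset_trans sBS' (subsetDl _ _).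
    move=> x y xB yS exy; apply: (clB x) => //; rewrite inE yS andbT.
    apply/bigcupP=> -[B' B'bs yB']; have [_ _ clB'] := C4_componentP B'bs.
    have /setDP[xSR /bigcupP[]] := subsetP sBS' _ xB.
    by exists B' => //; apply: (clB' y) => //; rewrite eC.
  have /set0Pn[x xB] : B != set0 by rewrite -card_gt0 (card_C4 cB).
  by have /setDP[_ /bigcupP[]] := subsetP sBS' _ xB; exists B.
exists (D :|: D'); split; last first.
  by have := cardsUI D D'; lia.
move=> Z cZ sZS.
have [/exists_inP[x xZ xR]|/exists_inPn noR] := boolP [exists x in Z, x \in R].
  exact: hits_sub (subsetUl _ _) (hitR _ _ cZ sZS xZ xR).
have sZSR : Z \subset S :\: R.
  by apply/subsetP=> x xZ; rewrite inE noR // (subsetP sZS).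
have [/exists_inP[x xZ /bigcupP[B Bbs xB]]|/exists_inPn noB] :=
    boolP [exists x in Z, x \in cover bs].
  by rewrite (C4_component_absorb Bbs cZ sZSR xZ xB); exact: hits_sub (subsetUl _ _) (hitB _ Bbs).
apply: hits_sub (subsetUr _ _) (isoD' _ cZ _).
by apply/subsetP=> x xZ; rewrite inE noB // (subsetP sZSR).
Qed.

(** Without an edge to [R], the set [B] would already be a bad component of [S]. *)
Lemma C4_component_attached S R B : C4_components S = set0 ->
  B \in C4_components (S :\: R) -> exists x y, [/\ x \in B, y \in R & e x y].
Proof.
move=> S0 /C4_componentP[sBSR cB clB].
have [/exists_inP[x xB /exists_inP[y yR exy]]|noE] :=
    boolP [exists x in B, [exists y in R, e x y]]; first by exists x, y.
have: B \in C4_components S; last by rewrite S0 inE.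
apply/C4_componentP; split=> //; first exact: subset_trans sBSR (subsetDl _ _).
move=> x y xB yS exy; apply: (clB x) => //; rewrite inE yS andbT.
apply: contra noE => yR; apply/exists_inP; exists x => //.
by apply/exists_inP; exists y.
Qed.

(** One vertex of [R] is chosen for each bad component; the choice is injective, so
the number [b] of bad components satisfies [5 * b <= #|R| + 4 * b]. *)
Lemma isolable_exits S R :
  smaller_isolable S -> C4_components S = set0 -> R \subset S ->
  (forall x y z, x \in R -> y \notin R -> z \notin R -> e x y -> e x z -> y = z) ->
  (forall r Z x, r \in R -> is_C4 Z -> x \in Z -> x \in R -> hits [set r] Z) ->
  C4_components (S :\: R) != set0 -> isolable S.
Proof.
move=> IH S0 sRS exitR hitR; set bs := C4_components _ => /set0Pn[B0 B0bs].
have [x0 _] := C4_component_attached S0 B0bs.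
(* [x0] is only a default: [fP] shows that the pick succeeds for every bad component. *)
pose f B := odflt x0 [pick x in R | [exists y in B, e x y]].
have fP B : B \in bs -> f B \in R /\ exists2 y, y \in B & e (f B) y.
  move=> Bbs; rewrite /f; case: pickP => [x /andP[xR /exists_inP[y yB exy]]|no].
    by split=> //; exists y.
  have [x [y [xB yR exy]]] := C4_component_attached S0 Bbs.
  by have /andP[] := no y; split=> //; apply/exists_inP; exists x; rewrite // eC.
have notR B y : B \in bs -> y \in B -> y \notin R.
  by case/C4_componentP=> /subsetP sB _ _ /sB; rewrite inE => /andP[].
(* A vertex of [R] has at most one neighbour outside [R], so two components with the same image
   share that neighbour. *)
have injf : {in bs &, injective f}.
  move=> B B' Bbs B'bs eqf; have [fR [y yB ey]] := fP B Bbs.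
  have [_ [y' yB' ey']] := fP B' B'bs; rewrite -eqf in ey'.
  have eqy := exitR _ _ _ fR (notR _ _ Bbs yB) (notR _ _ B'bs yB') ey ey'.
  by apply: (C4_components_disjoint Bbs B'bs yB); rewrite eqy.
have sDR : f @: bs \subset R.
  by apply/subsetP=> x /imsetP[B Bbs ->]; case: (fP B Bbs).
have fD B : B \in bs -> f B \in f @: bs by exact: imset_f.
have hitD r Z : r \in f @: bs -> hits [set r] Z -> hits (f @: bs) Z.
  by move=> rD; apply: hits_sub; rewrite sub1set.
have B0R := subsetP sDR _ (fD _ B0bs).
apply: (@isolable_reduce S R (f @: bs)) => //.
- by apply/set0Pn; exists (f B0).
- move=> Z x cZ _ xZ xR; apply: hitD (fD _ B0bs) _; exact: hitR xZ xR.
- move=> B Bbs; have [_ [y yB ey]] := fP B Bbs; exists y => //.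
  exact: nbhd_edge (fD _ Bbs) ey.
- rewrite -/bs; move: (subset_leq_card sDR); rewrite card_in_imset //; move: #|bs| #|R| => m n; lia.
Qed.

(** * Copies of K_{2,3} *)

Lemma hits_via_set Z D W x : is_C4 Z -> x \in Z -> 1 < #|W| ->
  (forall w, w \in W -> e x w /\ w \in closed_nbhd e D) -> hits D Z.
Proof.
move=> cZ xZ /card_gt1P[y [z [yW zW yz]]] nW.
have [exy yD] := nW y yW; have [exz zD] := nW z zW.
exact: hits_via cZ xZ yz exy exz yD zD.
Qed.

Definition is_K23 P Q : bool :=
  [&& #|P| == 2, #|Q| == 3 & [forall p in P, forall q in Q, e p q]].

(** Let [a], [c] be the neighbours of [w] on [Z], and [b] the opposite vertex. If [a] and [c] are
    opposite on [B], they share [w] and the other two vertices of [B] as neighbours. Otherwise the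
    degree bound fails: at [a] if [b] is opposite to [a] on [B], and at [c] if not. *)
Lemma K23_of_overlap B Z w :
  is_C4 B -> is_C4 Z -> w \in Z -> w \notin B -> Z \subset w |: B ->
  exists P Q, [/\ P \subset w |: B, Q \subset w |: B & is_K23 P Q].
Proof.
move=> cB cZ wZ wB sZB.
have [a [b [c [defZ cyc]]]] := C4_rooted cZ wZ.
have /and5P[/= uqZ ewa eab ebc ecw] := cyc.
move: uqZ; rewrite !inE !negb_or -!andbA => /and5P[wa wb wc ab /and3P[ac bc _]].
have inB t : t \in Z -> w != t -> t \in B.
  by move=> /(subsetP sZB); rewrite !inE => /predU1P[->|//]; rewrite eqxx.
have aB : a \in B by apply: inB; rewrite // defZ !inE eqxx ?orbT.
have bB : b \in B by apply: inB; rewrite // defZ !inE eqxx ?orbT.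
have cB' : c \in B by apply: inB; rewrite // defZ !inE eqxx ?orbT.
have wNB v : v \in B -> w != v by apply: contraTneq => <-.
have [s [t [r [defB /and5P[/= uqB eas est etr era]]]]] := C4_rooted cB aB.
move: uqB; rewrite !inE !negb_or -!andbA => /and5P[as_ at_ ar st /and3P[sr tr _]].
have [sB tB rB] : [/\ s \in B, t \in B & r \in B] by rewrite defB !inE !eqxx ?orbT.
have [ct|nct] := eqVneq c t.
  exists [set a; c], (w |: [set s; r]); split.
  - by rewrite subUset !sub1set !inE aB cB' !orbT.
  - by rewrite !subUset !sub1set !inE sB rB eqxx !orbT.
  rewrite /is_K23 cards2 ac cardsU1 cards2 sr !inE negb_or !wNB //=.
  apply/forall_inP=> p /set2P[]->; apply/forall_inP=> v;
    rewrite !inE => /or3P[] /eqP->;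
    do [by [] | by rewrite eC | by rewrite ct | by rewrite ct eC].
exfalso; have nbt : b == t -> False.
  move=> /eqP bt; apply: (@degree_lt4 a w s t r).
  - by rewrite /= !inE !negb_or !wNB // st sr tr.
  - by rewrite eC.
  - by [].
  - by rewrite -bt.
  - by rewrite eC.
move: (cB') (bB); rewrite {1 2}defB !inE -!orbA (negPf nct) (eq_sym c) (negPf ac) /=.
rewrite (eq_sym b) (negPf ab) /= => csr /or3P[|/nbt//|]; case/orP: csr => /eqP cE /eqP bE.
- by rewrite cE bE eqxx in bc.
- apply: (@degree_lt4 c w a t b) => //.
  + by rewrite /= !inE !negb_or !wNB // at_ ab bE (eq_sym t) st.
  + by rewrite cE.
  + by rewrite cE eC.
  + by rewrite eC.
- apply: (@degree_lt4 c w a t b) => //.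
  + by rewrite /= !inE !negb_or !wNB // at_ ab bE tr.
  + by rewrite cE eC.
  + by rewrite cE.
  + by rewrite eC.
- by rewrite cE bE eqxx in bc.
Qed.

(** Each vertex of the K_{2,3} alone hits every 4-cycle meeting it, and its five vertices pay for
    one. The degree bound leaves no exit to the vertices of [P] and at most one to each vertex of
    [Q]. *)
Lemma isolable_K23 S P Q :
  smaller_isolable S -> C4_components S = set0 -> P \subset S -> Q \subset S ->
  is_K23 P Q -> isolable S.
Proof.
move=> IH S0 sPS sQS /and3P[/eqP cP /eqP cQ /forall_inP ePQ'].
have ePQ p q : p \in P -> q \in Q -> e p q by move=> /ePQ'/forall_inP; exact.
have eQP q p : q \in Q -> p \in P -> e q p by move=> qQ pP; rewrite eC ePQ.
have disPQ : P :&: Q = set0.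
  apply/setP=> x; rewrite !inE; apply/negP=> /andP[xP xQ].
  by move: (ePQ _ _ xP xQ); rewrite eI.
have cR : #|P :|: Q| = 5 by rewrite cardsU disPQ cards0 cP cQ.
have sRS : P :|: Q \subset S by rewrite subUset sPS.
have hitR r Z x : r \in P :|: Q -> is_C4 Z -> x \in Z -> x \in P :|: Q ->
    hits [set r] Z.
  have n1 : r \in [set r] by rewrite inE.
  rewrite !inE => /orP[rP|rQ] cZ xZ /orP[xP|xQ].
  - apply: (hits_via_set cZ xZ (W := Q)) => [|w wQ]; first by rewrite cQ.
    by split; [exact: ePQ | apply: nbhd_edge n1 _; exact: ePQ].
  - by exists x => //; apply: nbhd_edge n1 _; exact: ePQ.
  - by exists x => //; apply: nbhd_edge n1 _; exact: eQP.
  - apply: (hits_via_set cZ xZ (W := P)) => [|w wP]; first by rewrite cP.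
    by split; [exact: eQP | apply: nbhd_edge n1 _; exact: eQP].
have [comp0|] := eqVneq (C4_components (S :\: (P :|: Q))) set0; last first.
  apply: isolable_exits => // x y z.
  rewrite !inE !negb_or => xR /andP[yP yQ] /andP[zP zQ] exy exz.
  apply/eqP; apply: contraT => yz; exfalso.
  case/orP: xR => [xP|xQ].
    have: #|y |: Q| <= 3.
      apply: leq_trans (degG x); apply/subset_leq_card/subsetP=> w.
      by rewrite !inE => /predU1P[->//|wQ]; exact: ePQ.
    by rewrite cardsU1 yQ cQ.
  have: #|y |: (z |: P)| <= 3.
    apply: leq_trans (degG x); apply/subset_leq_card/subsetP=> w.
    by rewrite !inE => /or3P[/eqP->|/eqP->|wP] //; exact: eQP.
  by rewrite !cardsU1 !inE negb_or yz yP zP cP.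
have /set0Pn[p pP] : P != set0 by rewrite -card_gt0 cP.
have pR : p \in P :|: Q by rewrite inE pP.
apply: (@isolable_reduce S (P :|: Q) [set p]) => //.
- by apply/set0Pn; exists p.
- by move=> Z x cZ _ xZ xR; exact: hitR cZ xZ xR.
- by move=> B; rewrite comp0 inE.
- by rewrite cR cards1 leq_addr.
Qed.

(** * Removing a 4-cycle, and the induction *)

(** Each vertex of [Q] has at most one neighbour outside [Q], so [isolable_exits] applies if
    removing [Q] leaves bad components. Otherwise [Q] and an outside neighbour [w] make five
    vertices, and the number of bad components left after removing them decides which ones
    dominate. *)
Lemma isolable_C4 S Q :
  smaller_isolable S -> C4_components S = set0 ->
  (forall w, w \in S -> C4_components (S :\ w) = set0) ->
  (forall P P', P \subset S -> P' \subset S -> ~~ is_K23 P P') ->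
  Q \subset S -> is_C4 Q -> isolable S.
Proof.
move=> IH S0 cut0 noK23 sQS cQ.
have two_nbrs x : x \in Q -> exists y z, [/\ y \in Q, z \in Q, y != z, e x y & e x z].
  move=> xQ; have [y [u [z [-> /and5P[uq exy _ _ ezx]]]]] := C4_rooted cQ xQ.
  exists y, z; rewrite !inE !eqxx ?orbT; split=> //; last by rewrite eC.
  by move: uq; rewrite /= !inE !negb_or -!andbA => /and5P[_ _ _ _ /andP[]].
have exitQ : forall x y z,
    x \in Q -> y \notin Q -> z \notin Q -> e x y -> e x z -> y = z.
  move=> x y z xQ yQ zQ exy exz; apply/eqP; apply: contraT => yz; exfalso.
  have [a [b [aQ bQ ab exa exb]]] := two_nbrs x xQ.
  apply: (@degree_lt4 x y z a b) => //.
  rewrite /= !inE !negb_or yz ab /= !andbT -!andbA.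
  by apply/and4P; split; [apply: contraNneq yQ | apply: contraNneq yQ
                         | apply: contraNneq zQ | apply: contraNneq zQ] => ->.
have [compQ|] := eqVneq (C4_components (S :\: Q)) set0; last first.
  by apply: isolable_exits => // r Z x rQ cZ xZ xQ; exact: C4_hit_from xZ xQ.
have [q [w [qQ wS wQ eqw]]] : exists q w, [/\ q \in Q, w \in S, w \notin Q & e q w].
  have [/exists_inP[q qQ /exists_inP[w /setDP[wS wQ] eqw]]|noE] :=
      boolP [exists q in Q, [exists w in S :\: Q, e q w]]; first by exists q, w.
  have: Q \in C4_components S; last by rewrite S0 inE.
  apply/C4_componentP; split=> // x y xQ yS exy; apply: contraNT noE => yQ.
  by apply/exists_inP; exists x => //; apply/exists_inP; exists y; rewrite // inE yQ.
have n1 x : x \in [set x] by rewrite inE.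
have sRS : w |: Q \subset S by rewrite subUset sub1set wS.
have R0 : w |: Q != set0 by apply/set0Pn; exists w; rewrite !inE eqxx.
have cR : #|w |: Q| = 5 by rewrite cardsU1 wQ (card_C4 cQ).
(* The same set read in two ways: since neither [S :\: Q] nor [S :\ w] has bad components, every bad
   component left is attached both to [w] and to [Q]. *)
have defSw : S :\: (w |: Q) = S :\: Q :\: [set w] by rewrite setDDl setUC.
have defSQ : S :\: (w |: Q) = S :\ w :\: Q by rewrite setDDl.
have hitQ Z x : is_C4 Z -> x \in Z -> x \in w |: Q -> hits [set q] Z.
  move=> cZ xZ; rewrite !inE => /predU1P[xw|xQ]; last exact: C4_hit_from xZ xQ.
  by exists x => //; rewrite xw; exact: nbhd_edge eqw.
have [comp0|/set0Pn[B BS]] := eqVneq (C4_components (S :\: (w |: Q))) set0.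
  apply: (@isolable_reduce S (w |: Q) [set q]) => //.
  - by move=> Z x cZ _ xZ xR; exact: hitQ cZ xZ xR.
  - by move=> B; rewrite comp0 inE.
  - by rewrite cR cards1 leq_addr.
have adjw B' : B' \in C4_components (S :\: (w |: Q)) -> exists2 y, y \in B' & e w y.
  rewrite defSw => B'S; have [y [v [yB' vw]]] := C4_component_attached compQ B'S.
  by move: vw; rewrite inE => /eqP->; rewrite eC; exists y.
(* With two or more bad components at least [5 + 4 * 2] vertices go, enough to pay for two: [w] hits
   the components and [q] the 4-cycles meeting [w |: Q]. *)
have [B1|] := leqP #|C4_components (S :\: (w |: Q))| 1; last first.
  move=> gt1; apply: (@isolable_reduce S (w |: Q) [set w; q]) => //.
  - move=> Z x cZ _ xZ xR; apply: hits_sub (hitQ _ _ cZ xZ xR).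
    by rewrite sub1set !inE eqxx orbT.
  - move=> B' /adjw[y yB' ewy]; exists y => //.
    by apply: nbhd_edge ewy; rewrite !inE eqxx.
  - rewrite cR; apply: (@leq_trans (5 * 2)); first by rewrite cards2; case: eqVneq.
    by apply: (@leq_trans (5 + 4 * 2)) => //; rewrite leq_add2l leq_mul2l.
(* With a single bad component [B], a neighbour in [Q] of a vertex of [B] suffices:
   a 4-cycle it misses avoids [Q], so lies in [w |: B] and yields a K_{2,3}. *)
have onlyB B' : B' \in C4_components (S :\: (w |: Q)) -> B' = B.
  by move=> B'S; apply: (card_le1_eqP B1).
have [r [q' [rB q'Q erq']]] : exists r q', [/\ r \in B, q' \in Q & e r q'].
  by apply: (@C4_component_attached (S :\ w)); [exact: cut0 | rewrite -defSQ].
have [sBS cB clB] := C4_componentP BS.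
have [y yB ewy] := adjw B BS.
have notR t : t \in B -> t \notin w |: Q by move/(subsetP sBS); rewrite inE => /andP[].
have wB : w \notin B by apply/negP=> /notR; rewrite !inE eqxx.
have qB : q \notin B by apply/negP=> /notR; rewrite !inE qQ orbT.
apply: (@isolable_reduce S (w |: Q) [set q']) => //; last by rewrite cR cards1 leq_addr.
  move=> Z x cZ sZS xZ xR.
  have [/exists_inP[t tZ tQ]|/exists_inPn ZQ] := boolP [exists t in Z, t \in Q].
    exact: C4_hit_from tZ tQ.
  exfalso.
  have wZ : w \in Z by move: xR; rewrite !inE (negPf (ZQ x xZ)) orbF => /eqP<-.
  (* [y] and [q] are both neighbours of [w], so [Z] contains one of them; it avoids [Q], hence
     contains [y]. *)
  have yq : y != q by apply: contraNneq qB => <-.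
  have yZ : y \in Z.
    have:= C4_meets_pair cZ wZ yq ewy; rewrite (eC w q) eqw => /(_ isT) /orP[] // qZ.
    by move: (ZQ q qZ); rewrite qQ.
  have closed_step t t' : t \in B -> t' \in Z -> t' != w -> e t t' -> t' \in B.
    move=> tB tZ tw; apply: clB => //.
    by rewrite !inE (negPf tw) (negPf (ZQ t' tZ)) (subsetP sZS).
  (* From [y] in [B], a step along [Z] stays in [B] or reaches [w]. The vertex opposite to [y] is
     reached from whichever of its two cycle neighbours is not [w]. *)
  have sZB : Z \subset w |: B.
    have [a [b [c [defZ /and5P[/= uqZ eya eab ebc ecy]]]]] := C4_rooted cZ yZ.
    have [aZ bZ cZ'] : [/\ a \in Z, b \in Z & c \in Z] by rewrite defZ !inE !eqxx ?orbT.
    have step t t' : t \in B -> t' \in Z -> e t t' -> t' \in w |: B.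
      rewrite !inE; case: eqVneq => //= t'w tB t'Z; exact: closed_step.
    have aB := step _ _ yB aZ eya.
    have cB' : c \in w |: B by apply: (step y); rewrite // eC.
    rewrite defZ; apply/subsetP=> t; rewrite !in_setU !in_set1 -!orbA.
    case/or4P=> /eqP->; first by rewrite yB orbT.
    - by move: aB; rewrite !inE.
    - move: aB cB'; rewrite !inE; case/predU1P=> [aw|aB]; last first.
        by have := step _ _ aB bZ eab; rewrite !inE.
      case/predU1P=> [cw|cB']; last by have := step _ _ cB' bZ; rewrite eC !inE; exact.
      by move: uqZ; rewrite aw cw /= !inE eqxx !orbT andbF.
    - by move: cB'; rewrite !inE.
  have [P [P' [sP sP' K]]] := K23_of_overlap cB cZ wZ wB sZB.
  have sBS' : w |: B \subset S.
    by rewrite subUset sub1set wS (subset_trans sBS (subsetDl _ _)).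
  by have := noK23 _ _ (subset_trans sP sBS') (subset_trans sP' sBS'); rewrite K.
move=> B' /onlyB->; exists r => //; apply: nbhd_edge (n1 q') _.
by rewrite eC.
Qed.

Lemma isolable_no_C4_component S : C4_components S = set0 -> isolable S.
Proof.
have [n] := ubnP #|S|; elim: n S => // n IHn S ltSn S0.
have IH : smaller_isolable S.
  by move=> S' ltS'; apply: IHn; apply: leq_trans (proper_card ltS') _.
have [/exists_inP[w wS cut]|/exists_inPn cut0] :=
    boolP [exists w in S, C4_components (S :\ w) != set0].
  have n1 : w \in [set w] by rewrite inE.
  apply: (@isolable_reduce S [set w] [set w]) => //.
  - by rewrite sub1set.
  - by apply/set0Pn; exists w.
  - move=> Z x _ _ xZ; rewrite inE => /eqP xw; exists x => //.
    by rewrite xw; exact: nbhd_self.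
  - move=> B BS; have [x [y [xB]]] := C4_component_attached S0 BS.
    rewrite inE => /eqP-> exw; exists x => //; apply: nbhd_edge n1 _.
    by rewrite eC.
  (* A nonzero number [m] of bad components gives [5 <= 1 + 4 * m]. *)
  - by rewrite cards1; move: cut; rewrite -card_gt0; move: #|_| => m; lia.
have [/existsP[P /existsP[P' /and3P[sP sP' K]]]|noK] :=
    boolP [exists P : {set T}, exists P' : {set T}, [&& P \subset S, P' \subset S & is_K23 P P']].
  exact: isolable_K23 IH S0 sP sP' K.
have [/existsP[Q /andP[sQS cQ]]|noC4] := boolP [exists Q : {set T}, (Q \subset S) && is_C4 Q].
  apply: isolable_C4 cQ => // [w wS|P P' sP sP'].
    by apply/eqP; rewrite -[_ == _]negbK cut0.
  apply: contra noK => K; apply/existsP; exists P; apply/existsP; exists P'.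
  by rewrite sP sP'.
exists set0; split; last by rewrite cards0.
by move=> Z cZ sZS; case/existsP: noC4; exists Z; rewrite sZS.
Qed.

(** * The exceptional graphs and the conclusion *)

Lemma isomorphic_enum (f : rel 'I_4) (s : 4.-tuple T) :
  uniq s -> (forall x, x \in s) -> (forall i j, f i j = e (tnth s i) (tnth s j)) ->
  isomorphic e f.
Proof.
move=> uq mem_s ef; have idx x : index x s < 4 by rewrite -[X in _ < X](size_tuple s) index_mem.
have tnth_idx x : tnth s (Ordinal (idx x)) = x.
  by rewrite (tnth_nth x) /= nth_index.
exists (fun x => Ordinal (idx x)); split=> [|x y]; last by rewrite ef !tnth_idx.
exists (tnth s) => [x|i]; first exact: tnth_idx.
by apply: val_inj; rewrite /= (tnth_nth (tnth s i)) index_uniq ?size_tuple.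
Qed.

(** Which of the two chords are present decides the isomorphism type. *)
Lemma spanning_four_cycle x y z u :
  four_cycle x y z u -> (forall v, v \in [:: x; y; z; u]) ->
  [\/ isomorphic e C4_rel, isomorphic e diamond_rel | isomorphic e K4_rel].
Proof.
case/and5P=> uq exy eyz ezu eux mem.
have [eyx ezy euz exu] : [/\ e y x, e z y, e u z & e x u] by split; rewrite eC.
have E := (eI, exy, eyx, eyz, ezy, ezu, euz, eux, exu, eC z x, eC u y).
have [exz|/negPf exz] := boolP (e x z); have [eyu|/negPf eyu] := boolP (e y u).
- constructor 3; apply: (isomorphic_enum (s := [tuple x; y; z; u])) => //.
  by do 2![case=> [[|[|[|[|?]]]] ?] //]; rewrite /tnth /= !(E, exz, eyu).
- constructor 2; apply: (isomorphic_enum (s := [tuple x; y; z; u])) => //.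
  by do 2![case=> [[|[|[|[|?]]]] ?] //]; rewrite /tnth /= !(E, exz, eyu).
(* The only chord is [y u]; the rotation puts it at positions 0 and 2, the chord of
   [diamond_rel]. *)
- constructor 2; apply: (isomorphic_enum (s := [tuple y; z; u; x])) => [|v|].
  + by rewrite -(rot_uniq 3).
  + by rewrite -(mem_rot 3); exact: mem.
  by do 2![case=> [[|[|[|[|?]]]] ?] //]; rewrite /tnth /= !(E, exz, eyu).
- constructor 1; apply: (isomorphic_enum (s := [tuple x; y; z; u])) => //.
  by do 2![case=> [[|[|[|[|?]]]] ?] //]; rewrite /tnth /= !(E, exz, eyu).
Qed.

(** [B] is closed under adjacency in the whole graph, so by connectedness it contains every
    vertex. *)
Lemma C4_component_connected B : connected_graph e -> B \in C4_components setT ->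
  [\/ isomorphic e C4_rel, isomorphic e diamond_rel | isomorphic e K4_rel].
Proof.
move=> conn /C4_componentP[_ /is_C4P[x [y [z [u [defB cyc]]]]] clB].
apply: (spanning_four_cycle cyc) => v.
have clB' : closed e (mem B).
  move=> a b eab; apply/idP/idP => [aB|bB]; first by apply: (clB a).
  by apply: (clB b); rewrite // eC.
have vB : v \in B.
  by rewrite -(closed_connect clB' (conn x v)) defB !inE eqxx.
by move: vB; rewrite defB !inE -!orbA.
Qed.

End Isolation.

Theorem theorem3 (T : finType) (e : rel T) :
  simple_graph e ->
  connected_graph e ->
  max_degree_le e 3 ->
  ~ isomorphic e C4_rel ->
  ~ isomorphic e diamond_rel ->
  ~ isomorphic e K4_rel ->
  exists D : {set T}, C4_isolating e D /\ #|D| <= #|T| %/ 5.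
Proof.
move=> eG conn degG notC4 notDiamond notK4.
have [|D [isoD cardD]] := isolable_no_C4_component eG degG (S := setT).
  apply/eqP; apply: contraT => /set0Pn[B BT].
  by case: (C4_component_connected eG conn BT).
exists D; split; last by rewrite leq_divRL // mulnC -cardsT.
case=> a [b [c [d [[]]]]]; rewrite !in_setC => aD bD cD dD uq [eab ebc ecd eda].
have [||x + xN] := isoD [set a; b; c; d]; last 1 first.
- by rewrite !inE -!orbA => /or4P[] /eqP xE; move: xN; rewrite xE; apply/negP.
- by apply/is_C4P; exists a, b, c, d; split=> //; apply/and5P.
- exact: subsetT.
Qed.
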